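(* Let $(X,\tau)$ be a metrizable space and $a\in X$. The family $\mathcal L^m_a(\tau)$ is closed under nonempty finite joins and meets in the lattice of all topologies on $X$. For $s,t\in\mathcal G_a(\tau)$, $$\tau_s\vee\tau_t=\tau_{\max(s,t)},\qquad\tau_s\wedge\tau_t=\tau_{\min(s,t)},$$ where $\max(s,t)$ and $\min(s,t)$ are the pointwise maximum and minimum. Moreover, $\mathcal L^m_a(\tau)$ is a distributive lattice with greatest element $\tau$.
   Context: $X$ is a nonempty set. $\mathcal L^m_a(\tau)$ denotes the set, ordered by inclusion, of all metrizable topologies $\sigma$ on $X$ with $\sigma\subseteq\tau$ and $\sigma|_{X\setminus\{a\}}=\tau|_{X\setminus\{a\}}$ (equality of subspace topologies). $\mathcal G_a(\tau)$ denotes the set of $\tau$-continuous functions $s:X\to[0,\infty)$ with $s^{-1}(0)=\{a\}$. Fix a metric $d\le1$ inducing $\tau$. For $s\in\mathcal G_a(\tau)$, $\tau_s$ denotes the topology induced by the metric $\rho_s(x,y)=|s(x)-s(y)|+\min\{s(x),s(y)\}d(x,y)$; it does not depend on the choice of such $d$. In the lattice of all topologies on $X$ (ordered by inclusion), the join $\vee$ of two topologies is the topology generated by their union and the meet $\wedge$ is their intersection. *)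

(* Defs.v *)
From HB Require Import structures.
From mathcomp Require Import all_boot all_order all_algebra.
From mathcomp Require Import all_classical all_reals all_analysis.
Import Order.TTheory GRing.Theory Num.Theory.
Import numFieldNormedType.Exports.

Set Implicit Arguments.
Unset Strict Implicit.
Unset Printing Implicit Defensive.

Local Open Scope classical_set_scope.
Local Open Scope ring_scope.

(* Several topologies on the same carrier are compared here, so a topology is
   represented by its family of open sets rather than by a topologicalType. *)
Definition is_topology (X : Type) (sigma : set (set X)) : Prop :=
  [/\ sigma setT,
      setI_closed sigma &
      forall F : set (set X), F `<=` sigma -> sigma (\bigcup_(U in F) U)].

Definition topology_sup (X : Type) (F : set (set (set X))) : set (set X) :=
  smallest (@is_topology X) (\bigcup_(sigma in F) sigma).

Definition topology_join (X : Type) (sigma1 sigma2 : set (set X)) :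
    set (set X) :=
  smallest (@is_topology X) (sigma1 `|` sigma2).

Definition subspace_open (X : Type) (sigma : set (set X)) (A : set X) :
    set (set X) :=
  [set U `&` A | U in sigma].

(* Nonnegativity of d follows from the other axioms. *)
Definition is_metric (R : realType) (X : Type) (d : X -> X -> R) : Prop :=
  [/\ forall x y, d x y = 0 <-> x = y,
      forall x y, d x y = d y x &
      forall x y z, d x z <= d x y + d y z].

Definition metric_topology (R : realType) (X : Type) (d : X -> X -> R) :
    set (set X) :=
  [set U | forall x, U x ->
     exists2 e : R, 0 < e & [set y | d x y < e] `<=` U].

Definition metrizable (R : realType) (X : Type) (sigma : set (set X)) : Prop :=
  exists2 d : X -> X -> R, is_metric d & metric_topology d = sigma.

Definition Lm (R : realType) (X : Type) (a : X) (tau : set (set X)) :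
    set (set (set X)) :=
  [set sigma | [/\ metrizable R sigma,
                   sigma `<=` tau &
                   subspace_open sigma (~` [set a]) =
                   subspace_open tau (~` [set a])]].

Definition Ga (R : realType) (X : topologicalType) (a : X) : set (X -> R) :=
  [set s : X -> R |
    [/\ continuous s, forall x, 0 <= s x & s @^-1` [set 0] = [set a]]].

Definition rho (R : realType) (X : Type) (d : X -> X -> R) (s : X -> R)
    (x y : X) : R :=
  `|s x - s y| + Num.min (s x) (s y) * d x y.

Definition tau_ (R : realType) (X : Type) (d : X -> X -> R) (s : X -> R) :
    set (set X) :=
  metric_topology (rho d s).

(* L, ordered by inclusion, is a distributive lattice with greatest element
   top: it is order isomorphic, through f, to such a lattice. *)
Definition distr_lattice_with_top (T : Type) (L : set (set T)) (top : set T) :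
    Prop :=
  exists (disp : Order.disp_t) (D : tDistrLatticeType disp) (f : D -> set T),
    [/\ set_bij setT L f,
        forall x y : D, (x <= y)%O <-> f x `<=` f y &
        f \top%O = top].

(* Main.v *)
Require Import Defs.
From HB Require Import structures.
From mathcomp Require Import all_boot all_order all_algebra.
From mathcomp Require Import all_classical all_reals all_analysis.
From mathcomp Require Import lra.
Import Order.TTheory GRing.Theory Num.Theory.
Import numFieldNormedType.Exports.

Set Implicit Arguments.
Unset Strict Implicit.
Unset Printing Implicit Defensive.

Local Open Scope classical_set_scope.
Local Open Scope ring_scope.

(** The proof rests on a description of the topologies [tau_ d s] that does not
    mention the metric: a set is open for [tau_ d s] exactly when it is open for
    the original topology and, if it contains [a], contains a sublevel set
    [s x < e] with [e > 0] (lemma [tau_coarsening]).  Call this topology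
    [coarsening a s].

    Every member [sigma] of [Lm R a open] has this form (lemma
    [Lm_coarsening]): if [delta] is a metric inducing [sigma], take
    [s := delta a], the distance to [a].  Away from [a] the topology [sigma]
    agrees with the original one, and near [a] its neighbourhoods are the
    sublevel sets of [s].  Conversely each [coarsening a s] belongs to
    [Lm R a open] (lemma [coarsening_Lm]), being induced by the metric
    [rho d s] for any metric [d <= 1] inducing the original topology; such a
    [d] is obtained by truncating an arbitrary one.

    Joins and meets are then read off the sublevel sets at [a].  The sublevel
    sets of [max(s, t)] are the intersections of those of [s] and [t], which
    gives the join (lemma [coarsening_join]); a set contains a sublevel set of
    both [s] and [t] if and only if it contains one of [min(s, t)], which gives
    the meet (lemma [coarsening_meet]).  Closure under binary joins and meets
    follows, closure under finite ones is an induction, and distributivity is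
    inherited from the distributivity of [min] over [max] on real numbers. *)

(** * Topologies as families of open sets *)

Lemma is_topology_smallest (X : Type) (G : set (set X)) :
  is_topology (smallest (@is_topology X) G).
Proof.
split.
- by move=> T [[]].
- move=> A B AT BT T TG; have [[_ TI _] _] := TG.
  by apply: TI; [exact: AT|exact: BT].
- move=> F FT T TG; have [[_ _ TU] _] := TG; apply: TU => U FU.
  exact: FT TG.
Qed.

Lemma topology_joinE (X : Type) (s1 s2 T : set (set X)) :
  is_topology T -> s1 `<=` T -> s2 `<=` T ->
  (forall T', is_topology T' -> s1 `<=` T' -> s2 `<=` T' -> T `<=` T') ->
  topology_join s1 s2 = T.
Proof.
move=> topT s1T s2T Tmin; apply/seteqP; split.
  by apply: smallest_sub => //; rewrite subUset.
apply: Tmin; first exact: is_topology_smallest.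
- by apply: sub_smallest => U; left.
- by apply: sub_smallest => U; right.
Qed.

Lemma topology_join_sub (X : Type) (s1 s2 T : set (set X)) :
  is_topology T -> topology_join s1 s2 `<=` T <-> s1 `<=` T /\ s2 `<=` T.
Proof.
move=> topT; split=> [jT|[s1T s2T]].
  by split=> U sU; apply: jT; apply: sub_smallest sU => V; [left|right].
by apply: smallest_sub => //; rewrite subUset.
Qed.

Lemma topology_sup1 (X : Type) (s : set (set X)) :
  is_topology s -> topology_sup [set s] = s.
Proof. by move=> tops; rewrite /topology_sup bigcup_set1 smallest_id. Qed.

(** This lets a finite supremum be computed by merging two members at a time,
    which avoids ever meeting the supremum of the empty family. *)
Lemma topology_supU1 (X : Type) (s1 s2 : set (set X)) (F : set (set (set X))) :
  topology_sup (s1 |` (s2 |` F)) = topology_sup (topology_join s1 s2 |` F).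
Proof.
rewrite /topology_sup !bigcup_setU1; apply/seteqP; split.
- apply: smallest_sub; first exact: is_topology_smallest.
  move=> U [s1U|[s2U|FU]]; apply: sub_gen_smallest; last by right.
  + by left; apply: sub_gen_smallest; left.
  + by left; apply: sub_gen_smallest; right.
- apply: smallest_sub; first exact: is_topology_smallest.
  move=> U [|FU]; last by apply: sub_gen_smallest; right; right.
  apply: (smallest_sub (is_topology_smallest _)) U => U [s1U|s2U].
  + by apply: sub_gen_smallest; left.
  + by apply: sub_gen_smallest; right; left.
Qed.

(** * Metrics *)

Lemma metric_ge0 (R : realType) (X : Type) (d : X -> X -> R) x y :
  is_metric d -> 0 <= d x y.
Proof.
move=> [d0 dC dT]; have := dT x y x.
by rewrite (dC y x) (proj2 (d0 x x) erefl); lra.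
Qed.

Lemma is_topology_metric (R : realType) (X : Type) (d : X -> X -> R) :
  is_topology (metric_topology d).
Proof.
split.
- by move=> x _; exists 1.
- move=> A B Ao Bo x [Ax Bx].
  have [e e0 eA] := Ao _ Ax; have [f f0 fB] := Bo _ Bx.
  exists (Num.min e f); first by rewrite lt_min e0.
  by move=> y /=; rewrite lt_min => /andP[dxe dxf]; split; [exact: eA|exact: fB].
- move=> F Fo x [U FU Ux]; have [e e0 eU] := Fo _ FU _ Ux.
  by exists e => // y /eU; exists U.
Qed.

Lemma is_topology_metrizable (R : realType) (X : Type) (s : set (set X)) :
  metrizable R s -> is_topology s.
Proof. by move=> [d _ <-]; exact: is_topology_metric. Qed.

Lemma metric_topology_lipschitz (R : realType) (X : Type) (d : X -> X -> R)
    (f : X -> R) (c e : R) :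
  (forall x y, `|f x - f y| <= d x y) ->
  metric_topology d [set y | `|c - f y| < e].
Proof.
move=> fd x /= fx; exists (e - `|c - f x|); first by rewrite subr_gt0.
move=> y /= dxy.
have := fd x y; have := ler_distD (f x) c (f y); lra.
Qed.

Lemma metric_topologyC1 (R : realType) (X : Type) (d : X -> X -> R) (a : X) :
  is_metric d -> metric_topology d (~` [set a]).
Proof.
move=> dm x xa; exists (d x a).
  rewrite lt_neqAle metric_ge0// andbT; apply/negP => /eqP/esym.
  by have [d0 _ _] := dm; move=> /d0.
by move=> y /= dxy ya; rewrite ya ltxx in dxy.
Qed.

(** Truncating a metric at [1] does not change its small balls. *)
Lemma metrizable_le1 (R : realType) (X : Type) (s : set (set X)) :
  metrizable R s ->
  exists d : X -> X -> R,
    [/\ is_metric d, forall x y, d x y <= 1 & metric_topology d = s].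
Proof.
move=> [d dm <-]; have [d0 dC dT] := dm.
exists (fun x y => Num.min (d x y) 1); split.
- split.
  + move=> x y; rewrite -d0.
    split => [|->]; last by rewrite min_l.
    by rewrite minElt; case: ifP => // _ /eqP; rewrite oner_eq0.
  + by move=> x y; rewrite dC.
  + move=> x y z; have := dT x y z.
    have := metric_ge0 x y dm; have := metric_ge0 y z dm.
    case: (ltP (d x z) 1); case: (ltP (d x y) 1); case: (ltP (d y z) 1); lra.
- by move=> x y; rewrite ge_min lexx orbT.
- apply/seteqP; split=> U Uo x /Uo[e e0 eU].
  + exists e => // y /= dxy; apply: eU => /=.
    by rewrite gt_min dxy.
  + exists (Num.min e 1); first by rewrite lt_min e0 ltr01.
    move=> y /= dxy; apply: eU => /=.
    by move: dxy; rewrite lt_min !gt_min ltxx orbF => /andP[/orP[//|h1] h2]; lra.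
Qed.

(** Only the triangle inequality [rho x z <= rho x y + rho y z] needs care.
    Put [m := min(s x, s z)].  If [s y >= m], both weights on the right are at
    least [m] and the triangle inequalities of [d] and of the absolute value
    suffice.  If [s y < m], the detour through the lower level [s y] costs an
    extra [2 * (m - s y)] in the absolute values, while the weight of [d x z]
    only drops by [m - s y]; as [d x z <= 1], the loss is compensated. *)
Lemma rho_metric (R : realType) (X : Type) (d : X -> X -> R) (s : X -> R)
    (a : X) :
  is_metric d -> (forall x y, d x y <= 1) ->
  (forall x, 0 <= s x) -> (forall x, s x = 0 -> x = a) ->
  is_metric (rho d s).
Proof.
move=> dm d1 s0 sa; have [d0 dC dT] := dm; rewrite /rho.
have m0 x y : 0 <= Num.min (s x) (s y) by rewrite le_min !s0.
split.
- move=> x y; split=> [/eqP|->]; last first.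
    by rewrite subrr normr0 (proj2 (d0 y y) erefl) mulr0 addr0.
  rewrite paddr_eq0 ?normr_ge0 ?mulr_ge0 ?(metric_ge0 _ _ dm)//.
  rewrite normr_eq0 subr_eq0 mulf_eq0.
  move=> /andP[/eqP sxy]; rewrite sxy minxx => /orP[/eqP sy0|/eqP/d0//].
  by rewrite (sa y sy0); apply: sa; rewrite sxy.
- by move=> x y; rewrite distrC minC dC.
- move=> x y z; have := dT x y z; have := d1 x z.
  have := metric_ge0 x y dm; have := metric_ge0 y z dm.
  have := metric_ge0 x z dm; have := s0 y; have := s0 x; have := s0 z.
  have := ler_distD (s y) (s x) (s z).
  have [msy|sym] := leP (Num.min (s x) (s z)) (s y).
    have h1 : Num.min (s x) (s z) <= Num.min (s x) (s y).
      by rewrite le_min msy ge_min lexx.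
    have h2 : Num.min (s x) (s z) <= Num.min (s y) (s z).
      by rewrite le_min msy ge_min lexx orbT.
    have := m0 x z; move: h1 h2.
    move: (Num.min (s x) (s z)) (Num.min (s x) (s y)) (Num.min (s y) (s z)).
    move=> m m1 m2 mm1 mm2 mge0 hs _ _ _ dxz0 dyz0 dxy0 _ dxyz.
    have := ler_wpM2l mge0 dxyz; have := ler_wpM2r dxy0 mm1.
    by have := ler_wpM2r dyz0 mm2; lra.
  move: sym; rewrite lt_min => /andP[yx yz].
  rewrite (min_r (ltW yx)) (min_l (ltW yz)).
  rewrite (gtr0_norm (x := s x - s y)) ?subr_gt0//.
  rewrite (ltr0_norm (x := s y - s z)) ?subr_lt0// => _ sz0 sx0 sy0.
  move=> dxz0 dyz0 dxy0 dxz1 dxyz.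
  have := ler_wpM2l sy0 dxyz.
  have [xz|zx] := leP (s x) (s z).
  + rewrite distrC ger0_norm ?subr_ge0//.
    have : 0 <= (s x - s y) * (1 - d x z) by rewrite mulr_ge0 ?subr_ge0 // ltW.
    lra.
  + rewrite gtr0_norm ?subr_gt0//.
    have : 0 <= (s z - s y) * (1 - d x z) by rewrite mulr_ge0 ?subr_ge0 // ltW.
    lra.
Qed.

(** * Coarsening the neighbourhoods of one point *)

(** The neighbourhoods of [a] are replaced by those generated by the sublevel
    sets of [s]; all the other points keep their neighbourhoods. *)
Definition coarsening (R : realType) (X : topologicalType) (a : X)
    (s : X -> R) : set (set X) :=
  [set U | open U /\
     (U a -> exists2 e : R, 0 < e & [set x | s x < e] `<=` U)].

Lemma Ga_eq0 (R : realType) (X : topologicalType) (a : X) (s : X -> R) :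
  Ga a s -> forall x, s x = 0 <-> x = a.
Proof.
move=> [_ _ sa] x; split=> [sx0|->].
  by have : (s @^-1` [set 0]) x by []; rewrite sa.
by have : [set a] a by []; rewrite -sa.
Qed.

Lemma Ga_gt0 (R : realType) (X : topologicalType) (a : X) (s : X -> R) x :
  Ga a s -> x <> a -> 0 < s x.
Proof.
move=> Gs xa; have [_ s0 _] := Gs; rewrite lt_neqAle s0 andbT.
by apply/negP => /eqP/esym/(Ga_eq0 Gs).
Qed.

Lemma open_sublevel (R : realType) (X : topologicalType) (s : X -> R) (e : R) :
  continuous s -> open [set x | s x < e].
Proof.
by move=> cs; apply: (@open_comp _ _ s [set y | y < e]) => //; exact: open_lt.
Qed.

Lemma is_topology_coarsening (R : realType) (X : topologicalType) (a : X)
    (s : X -> R) :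
  is_topology (coarsening a s).
Proof.
split.
- by split; [exact: openT|exists 1].
- move=> A B [Ao Aa] [Bo Ba]; split; first exact: openI.
  move=> [/Aa[e e0 eA] /Ba[f f0 fB]].
  exists (Num.min e f); first by rewrite lt_min e0.
  by move=> y /=; rewrite lt_min => /andP[sye syf]; split; [exact: eA|exact: fB].
- move=> F FT; split; first by apply: bigcup_open => U /FT[].
  move=> [U FU Ua]; have [_ /(_ Ua)[e e0 eU]] := FT _ FU.
  by exists e => // y /eU; exists U.
Qed.

Lemma coarsening_mono (R : realType) (X : topologicalType) (a : X)
    (s t : X -> R) :
  (forall x, s x <= t x) -> coarsening a s `<=` coarsening a t.
Proof.
move=> st U [Uo Ua]; split => // /Ua[e e0 eU]; exists e => // x /= txe.
by apply: eU => /=; exact: le_lt_trans (st x) txe.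
Qed.

Lemma coarsening_notin (R : realType) (X : topologicalType) (a : X)
    (s : X -> R) (U : set X) :
  open U -> ~ U a -> coarsening a s U.
Proof. by split. Qed.

(** Around [a] the balls of [rho d s] are the sublevel sets of [s], because
    [rho d s a y = s y].  Around a point [x] with [s x > 0] the weight
    [Num.min (s x) (s y)] stays between [s x / 2] and [s x] as [y] approaches
    [x], so that [rho d s] and [d] have the same small neighbourhoods of [x]. *)
Lemma tau_coarsening (R : realType) (X : topologicalType) (a : X)
    (d : X -> X -> R) (s : X -> R) :
  is_metric d -> metric_topology d = open -> Ga a s ->
  tau_ d s = coarsening a s.
Proof.
move=> dm dX Gs; have [cs s0 _] := Gs.
have rhoa y : rho d s a y = s y.
  rewrite /rho (proj2 (Ga_eq0 Gs a) erefl) sub0r normrN min_l ?s0//.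
  by rewrite mul0r addr0 ger0_norm.
apply/seteqP; split=> U.
- move=> Uo; split; last first.
    move=> /Uo[e e0 eU]; exists e => // y /= sy.
    by apply: eU => /=; rewrite rhoa.
  rewrite -dX => x /Uo[e e0 eU].
  (* On this set the first term of [rho d s x y] is below [e / 2]; the factor
     [s x + 1] below bounds the weight of [d x y] while being nonzero even
     when [x = a]. *)
  have : metric_topology d [set y | `|s x - s y| < e / 2].
    rewrite dX; apply: (@open_comp _ _ s [set r | `|s x - r| < e / 2]) => //.
    exact: (@ball_open _ R (s x)).
  move=> /(_ x)[|f f0 fe]; first by rewrite /= subrr normr0 divr_gt0.
  have sx1 : 0 < s x + 1 by rewrite ltr_wpDl.
  exists (Num.min f (e / 2 / (s x + 1))).
    by rewrite lt_min f0/=; apply: divr_gt0 => //; exact: divr_gt0.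
  move=> y /=; rewrite lt_min ltr_pdivlMr// => /andP[/fe/= sxy dxy].
  apply: eU; rewrite /= /rho.
  have : Num.min (s x) (s y) * d x y <= (s x + 1) * d x y.
    by rewrite ler_wpM2r ?(metric_ge0 _ _ dm)// ge_min lerDl ler01.
  lra.
- rewrite /coarsening/= -dX => -[Uo Ua] x Ux.
  have [xa|xa] := pselect (x = a).
    rewrite xa; rewrite xa in Ux; have [e e0 eU] := Ua Ux; exists e => // y /=.
    by rewrite rhoa; exact: eU.
  have [e e0 eU] := Uo _ Ux; have sx0 := Ga_gt0 Gs xa.
  (* The first bound keeps [s y], hence the weight of [d x y], above
     [s x / 2]; the second then forces [d x y < e]. *)
  exists (Num.min (s x / 2) (e * (s x / 2))).
    have sx2 : 0 < s x / 2 by exact: divr_gt0.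
    by rewrite lt_min sx2/=; exact: mulr_gt0.
  move=> y; rewrite /= /rho lt_min => /andP[h1 h2]; apply: eU => /=.
  have m0 : 0 <= Num.min (s x) (s y) * d x y.
    by rewrite mulr_ge0 ?(metric_ge0 _ _ dm)// le_min !s0.
  have hm : s x / 2 <= Num.min (s x) (s y).
    have := ler_norm (s x - s y); rewrite le_min => h3.
    by apply/andP; split; lra.
  have := ler_wpM2r (metric_ge0 x y dm) hm.
  have := normr_ge0 (s x - s y) => n0 h3.
  have h4 : d x y * (s x / 2) < e * (s x / 2) by lra.
  by rewrite ltr_pM2r ?divr_gt0 in h4.
Qed.

(** The two topologies agree off [a] because deleting [a] from an open set
    leaves an open set on which the condition at [a] is void. *)
Lemma coarsening_Lm (R : realType) (X : topologicalType) (a : X) (s : X -> R) :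
  metrizable R (@open X) -> Ga a s -> Lm R a open (coarsening a s).
Proof.
move=> /metrizable_le1[d [dm d1 dX]] Gs; split.
- exists (rho d s); last exact: tau_coarsening.
  have [_ s0 _] := Gs; apply: (rho_metric (a := a)) => // x.
  exact: (proj1 (Ga_eq0 Gs x)).
- by move=> U [].
- apply/seteqP; split=> V [U].
    by move=> [Uo _] <-; exists U.
  move=> Uo <-; exists (U `&` ~` [set a]); last by rewrite -setIA setIid.
  apply: coarsening_notin; last by move=> [_]; exact.
  by apply: openI => //; rewrite -dX; exact: metric_topologyC1.
Qed.

(** The function [s] is the distance to [a] for a metric inducing [sigma]; it is
    continuous for [sigma], hence for the finer original topology.  The
    coincidence of both topologies off [a] makes the neighbourhoods of the
    other points agree, since [~` [set a]] is open in each. *)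
Lemma Lm_coarsening (R : realType) (X : topologicalType) (a : X)
    (sigma : set (set X)) :
  Lm R a open sigma -> exists2 s : X -> R, Ga a s & sigma = coarsening a s.
Proof.
move=> [[d dm dsigma] sub_tau eq_off_a]; have [d0 dC dT] := dm.
have d_lip x y : `|d a x - d a y| <= d x y.
  rewrite ler_norml; have := dT a x y; have := dT a y x; rewrite (dC y x).
  by move=> *; apply/andP; split; lra.
exists (d a).
  split.
  - move=> x; apply/cvgrPdist_lt => e e0; apply: open_nbhs_nbhs; split.
      apply: sub_tau; rewrite -dsigma.
      exact: (@metric_topology_lipschitz _ _ d (d a) (d a x)).
    by rewrite /= subrr normr0.
  - by move=> x; exact: metric_ge0.
  - apply/seteqP; split=> x /=; first by move=> /d0.
    by move=> ->; apply/d0.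
apply/seteqP; split=> U.
  move=> sU; split; first exact: sub_tau.
  by move=> Ua; move: sU; rewrite -dsigma => /(_ _ Ua).
move=> [Uo Ua]; rewrite -dsigma => x Ux.
have [xa|xa] := pselect (x = a).
  by rewrite xa; apply: Ua; rewrite -xa.
have : subspace_open open (~` [set a]) (U `&` ~` [set a]) by exists U.
rewrite -eq_off_a => -[V sV VU].
have : metric_topology d (V `&` ~` [set a]).
  have [_ topI _] := is_topology_metric d.
  by apply: topI; [rewrite dsigma|exact: metric_topologyC1].
by rewrite VU => /(_ x)[//|e e0 eU]; exists e => // y /eU[].
Qed.

(** * Joins and meets *)

Lemma Ga_max (R : realType) (X : topologicalType) (a : X) (s t : X -> R) :
  Ga a s -> Ga a t -> Ga a (fun x => Num.max (s x) (t x)).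
Proof.
move=> Gs Gt; have [cs s0 _] := Gs; have [ct t0 _] := Gt; split.
- by move=> x; apply: continuous_max; [exact: cs|exact: ct].
- by move=> x; rewrite le_max s0.
- apply/seteqP; split=> x /=.
    move=> m0; apply/(Ga_eq0 Gs)/eqP; rewrite eq_le s0 andbT.
    by rewrite -m0 le_max lexx.
  by move=> ->; rewrite (proj2 (Ga_eq0 Gs a)) // (proj2 (Ga_eq0 Gt a)) // maxxx.
Qed.

Lemma Ga_min (R : realType) (X : topologicalType) (a : X) (s t : X -> R) :
  Ga a s -> Ga a t -> Ga a (fun x => Num.min (s x) (t x)).
Proof.
move=> Gs Gt; have [cs s0 _] := Gs; have [ct t0 _] := Gt; split.
- by move=> x; apply: continuous_min; [exact: cs|exact: ct].
- by move=> x; rewrite le_min s0 t0.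
- apply/seteqP; split=> x /=.
    by rewrite minElt; case: ifP => _ => [/(Ga_eq0 Gs)|/(Ga_eq0 Gt)].
  by move=> ->; rewrite (proj2 (Ga_eq0 Gs a)) // (proj2 (Ga_eq0 Gt a)) // minxx.
Qed.

(** An open [U] that contains the intersection of the sublevel sets [s x < e]
    and [t x < e] is itself the intersection of the unions of [U] with each of
    them; these unions are open for [coarsening a s] and [coarsening a t]
    respectively. *)
Lemma coarsening_join (R : realType) (X : topologicalType) (a : X)
    (s t : X -> R) :
  continuous s -> continuous t ->
  topology_join (coarsening a s) (coarsening a t) =
    coarsening a (fun x => Num.max (s x) (t x)).
Proof.
move=> cs ct; apply: topology_joinE.
- exact: is_topology_coarsening.
- by apply: coarsening_mono => x; rewrite le_max lexx.
- by apply: coarsening_mono => x; rewrite le_max lexx orbT.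
move=> T [topT topI topU] sT tT U [Uo Ua].
have [/Ua[e e0 eU]|] := pselect (U a); last first.
  by move=> nUa; apply: sT; exact: coarsening_notin.
have -> : U = (U `|` [set x | s x < e]) `&` (U `|` [set x | t x < e]).
  rewrite -setUIr; apply/esym/setUidPl => x [/= sxe txe].
  by apply: eU; rewrite /= gt_max sxe.
apply: topI.
- apply: sT; split; first by apply: openU => //; exact: open_sublevel.
  by exists e => // x; right.
- apply: tT; split; first by apply: openU => //; exact: open_sublevel.
  by exists e => // x; right.
Qed.

Lemma coarsening_meet (R : realType) (X : topologicalType) (a : X)
    (s t : X -> R) :
  coarsening a s `&` coarsening a t =
    coarsening a (fun x => Num.min (s x) (t x)).
Proof.
apply/seteqP; split=> U.
- move=> [[Uo Us] [_ Ut]]; split => // Ua.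
  have [e e0 eU] := Us Ua; have [f f0 fU] := Ut Ua.
  exists (Num.min e f); first by rewrite lt_min e0.
  move=> x /=; rewrite gt_min !lt_min => /orP[] /andP[xe xf].
  + exact: eU.
  + exact: fU.
- move=> H; split; apply: coarsening_mono H => x; rewrite ge_min lexx ?orbT//.
Qed.

(** * Closure of the family of metrizable coarsenings *)

Lemma Lm_join (R : realType) (X : topologicalType) (a : X)
    (s1 s2 : set (set X)) :
  metrizable R (@open X) ->
  Lm R a open s1 -> Lm R a open s2 -> Lm R a open (topology_join s1 s2).
Proof.
move=> mX /Lm_coarsening[s Gs ->] /Lm_coarsening[t Gt ->].
have [cs _ _] := Gs; have [ct _ _] := Gt; rewrite coarsening_join//.
by apply: coarsening_Lm => //; exact: Ga_max.
Qed.

Lemma Lm_meet (R : realType) (X : topologicalType) (a : X)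
    (s1 s2 : set (set X)) :
  metrizable R (@open X) ->
  Lm R a open s1 -> Lm R a open s2 -> Lm R a open (s1 `&` s2).
Proof.
move=> mX /Lm_coarsening[s Gs ->] /Lm_coarsening[t Gt ->].
rewrite coarsening_meet; apply: coarsening_Lm => //; exact: Ga_min.
Qed.

Lemma Lm_top (R : realType) (X : topologicalType) (a : X) :
  metrizable R (@open X) -> Lm R a open (@open X).
Proof. by split. Qed.

Lemma Lm_is_topology (R : realType) (X : topologicalType) (a : X)
    (s : set (set X)) :
  Lm R a open s -> is_topology s.
Proof. by move=> [/is_topology_metrizable]. Qed.

Lemma Lm_join_meet_distr (R : realType) (X : topologicalType) (a : X)
    (s1 s2 s3 : set (set X)) :
  Lm R a open s1 -> Lm R a open s2 -> Lm R a open s3 ->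
  topology_join s1 s2 `&` s3 = topology_join (s1 `&` s3) (s2 `&` s3).
Proof.
move=> /Lm_coarsening[s Gs ->] /Lm_coarsening[t Gt ->] /Lm_coarsening[u Gu ->].
have [cs _ _] := Gs; have [ct _ _] := Gt.
have [csu _ _] := Ga_min Gs Gu; have [ctu _ _] := Ga_min Gt Gu.
rewrite coarsening_join// !coarsening_meet coarsening_join//.
by congr coarsening; apply/funext => x; rewrite min_maxl.
Qed.

Lemma set_seq_cons (T : eqType) (x : T) (l : seq T) :
  [set` x :: l] = x |` [set` l].
Proof.
apply/seteqP; split=> y /=; rewrite inE.
  by move=> /predU1P[|]; [left|right].
by move=> [->|->]; rewrite ?eqxx ?orbT.
Qed.

Lemma Lm_finite_sup_inf (R : realType) (X : topologicalType) (a : X)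
    (F : set (set (set X))) :
  metrizable R (@open X) ->
  finite_set F -> F !=set0 -> F `<=` Lm R a open ->
  Lm R a open (topology_sup F) /\ Lm R a open (\bigcap_(sigma in F) sigma).
Proof.
move=> mX /finite_seqP[l ->]; case: l => [[? //]|s l _].
elim: l s => [|t l IH] s FL.
  rewrite set_cons1 topology_sup1 ?bigcap_set1; last first.
    by apply: (@Lm_is_topology R _ a); apply: FL => /=; rewrite inE.
  by split; apply: FL; rewrite /= inE.
have Ls : Lm R a open s by apply: FL; rewrite /= inE eqxx.
have Lt : Lm R a open t by apply: FL; rewrite /= !inE eqxx orbT.
have Ll u : u \in l -> Lm R a open u.
  by move=> ul; apply: FL; rewrite /= !inE ul !orbT.
rewrite !set_seq_cons; split.
- rewrite topology_supU1 -set_seq_cons.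
  apply: (proj1 (IH _ _)) => u /=; rewrite inE => /orP[/eqP->|/Ll//].
  exact: Lm_join.
- rewrite !bigcap_setU1 setIA -(bigcap_setU1 id) -set_seq_cons.
  apply: (proj2 (IH _ _)) => u /=; rewrite inE => /orP[/eqP->|/Ll//].
  exact: Lm_meet.
Qed.

(** * The distributive lattice *)

(** The carrier of the lattice; the parameter [mX] is kept in the type because
    closure under the operations depends on it. *)
Definition Lm_type (R : realType) (X : topologicalType) (a : X)
    (mX : metrizable R (@open X)) : Type := set_type (Lm R a open).

HB.instance Definition _ R X a mX := SubChoice.on (@Lm_type R X a mX).

Section Lm_lattice.
Context (R : realType) (X : topologicalType) (a : X).
Context (mX : metrizable R (@open X)).
Local Notation L := (Lm_type a mX).

HB.instance Definition _ :=
  [SubChoice_isSubPOrder of L by <: with set_display].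

Lemma Lm_typeP (x : L) : Lm R a open (val x).
Proof. exact: set_mem (valP x). Qed.

Definition Lm_meet_op (x y : L) : L :=
  exist (fun s => s \in Lm R a open) _
    (mem_set (Lm_meet mX (Lm_typeP x) (Lm_typeP y))).

Definition Lm_join_op (x y : L) : L :=
  exist (fun s => s \in Lm R a open) _
    (mem_set (Lm_join mX (Lm_typeP x) (Lm_typeP y))).

Definition Lm_top_elt : L :=
  exist (fun s => s \in Lm R a open) _ (mem_set (Lm_top a mX)).

Lemma Lm_leE (x y : L) : (x <= y)%O <-> val x `<=` val y.
Proof. by rewrite -subsetEset leEsub. Qed.

Lemma Lm_meetP (x y z : L) :
  (x <= Lm_meet_op y z)%O = (x <= y)%O && (x <= z)%O.
Proof.
apply/idP/andP=> [/Lm_leE|[/Lm_leE xy /Lm_leE xz]].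
  by rewrite subsetI => -[xy xz]; split; apply/Lm_leE.
by apply/Lm_leE; rewrite subsetI.
Qed.

Lemma Lm_joinP (x y z : L) :
  (Lm_join_op x y <= z)%O = (x <= z)%O && (y <= z)%O.
Proof.
have tz := Lm_is_topology (Lm_typeP z).
apply/idP/andP=>
  [/Lm_leE/(topology_join_sub _ _ tz)[xz yz]|[/Lm_leE xz /Lm_leE yz]].
  by split; apply/Lm_leE.
by apply/Lm_leE/topology_join_sub.
Qed.

HB.instance Definition _ :=
  Order.POrder_MeetJoin_isLattice.Build _ L Lm_meetP Lm_joinP.

Lemma Lm_meetUl : left_distributive (@Order.meet _ L) (@Order.join _ L).
Proof. by move=> x y z; apply/val_inj/Lm_join_meet_distr; exact: Lm_typeP. Qed.

HB.instance Definition _ :=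
  Order.Lattice_Meet_isDistrLattice.Build _ L Lm_meetUl.

Lemma Lm_lex1 (x : L) : (x <= Lm_top_elt)%O.
Proof. by apply/Lm_leE; have [] := Lm_typeP x. Qed.

HB.instance Definition _ := Order.hasTop.Build _ L Lm_lex1.

Lemma Lm_distr_lattice : distr_lattice_with_top (Lm R a open) open.
Proof.
exists _, L, val; split.
- split.
  + by move=> x _; exact: Lm_typeP.
  + by move=> x y _ _; exact: val_inj.
  + by move=> s Ls; exists (exist (fun s => s \in Lm R a open) s (mem_set Ls)).
- exact: Lm_leE.
- by [].
Qed.

End Lm_lattice.

Theorem corollary3p6 (R : realType) (X : topologicalType) (a : X)
    (Xmetrizable : metrizable R (@open X)) :
  [/\ (forall F : set (set (set X)),
         finite_set F -> F !=set0 -> F `<=` Lm R a open ->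
         Lm R a open (topology_sup F) /\
         Lm R a open (\bigcap_(sigma in F) sigma)),
      (forall d : X -> X -> R,
         is_metric d -> (forall x y, d x y <= 1) -> metric_topology d = open ->
         forall s t : X -> R, Ga a s -> Ga a t ->
         topology_join (tau_ d s) (tau_ d t) =
           tau_ d (fun x => Num.max (s x) (t x)) /\
         tau_ d s `&` tau_ d t =
           tau_ d (fun x => Num.min (s x) (t x))) &
      distr_lattice_with_top (Lm R a open) open].
Proof.
split.
- by move=> F; exact: Lm_finite_sup_inf.
- move=> d dm _ dX s t Gs Gt; have [cs _ _] := Gs; have [ct _ _] := Gt.
  have GM := Ga_max Gs Gt; have Gm := Ga_min Gs Gt.
  rewrite (tau_coarsening dm dX Gs) (tau_coarsening dm dX Gt).
  rewrite (tau_coarsening dm dX GM) (tau_coarsening dm dX Gm).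
  by rewrite coarsening_join// coarsening_meet.
- exact: Lm_distr_lattice.
Qed.
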